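(* For every $n\ge 1$, the set $\{\pi\in\mathfrak{S}_n : \mathcal{T}(\pi)=\mathrm{id}\}$ equals the set $\mathfrak{S}_n(132)$ of permutations in $\mathfrak{S}_n$ that avoid the pattern $132$.
   Context: $\mathfrak{S}_n$ is the set of permutations of $\{1,\ldots,n\}$, written as words $\pi=\pi_1\cdots\pi_n$; $\mathrm{id}=12\cdots n$. The operator $\mathcal{T}$ (revstack sort) is defined recursively on finite words of distinct positive integers by $\mathcal{T}(\epsilon)=\epsilon$ for the empty word $\epsilon$, $\mathcal{T}(x)=x$ for a word $x$ of length 1, and $\mathcal{T}(LmR)=\mathcal{T}(R)\,\mathcal{T}(L)\,m$, where $m$ is the largest entry of the word $LmR$. A permutation avoids $132$ if it has no subsequence of entries $(a,c,b)$ (in this left-to-right order) with $a<b<c$. *)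

(* Defs.v *)
From mathcomp Require Import all_boot all_fingroup.

Set Implicit Arguments.
Unset Strict Implicit.
Unset Printing Implicit Defensive.

(* T(LmR) = T(R) T(L) m, with m the largest entry.  The recursion is on a fuel
   argument d; any d >= size w gives the same result (revstack_recE), and
   revstackE is the defining equation. *)
Fixpoint revstack_rec (d : nat) (w : seq nat) : seq nat :=
  if d is d'.+1 then
    if w is [::] then [::] else
      let m := \max_(x <- w) x in
      let i := index m w in
      revstack_rec d' (drop i.+1 w) ++ revstack_rec d' (take i w) ++ [:: m]
  else [::].

Definition revstack (w : seq nat) : seq nat := revstack_rec (size w) w.

(* The word s_1 ... s_n; since 'I_n is {0, ..., n-1}, entries are shifted by 1. *)
Definition perm_word (n : nat) (s : 'S_n) : seq nat :=
  [seq (s i).+1 | i <- enum 'I_n].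

Definition avoids132 (n : nat) (s : 'S_n) : bool :=
  [forall i : 'I_n, forall j : 'I_n, forall k : 'I_n,
     (i < j < k) ==> ~~ (s i < s k < s j)].

Lemma max_entry_mem (x : nat) (w : seq nat) :
  \max_(y <- x :: w) y \in x :: w.
Proof.
elim: w x => [|y w IH] x; first by rewrite big_seq1 mem_seq1.
rewrite big_cons; move: (IH y); set m := \max_(z <- _) z => mP.
by case: leqP => _; rewrite inE ?mP ?orbT ?eqxx.
Qed.

Lemma revstack_rec_fuel (d e : nat) (w : seq nat) :
  size w <= d -> size w <= e -> revstack_rec d w = revstack_rec e w.
Proof.
elim: d e w => [|d IH] [|e] [|x w] // le_d le_e.
rewrite /revstack_rec -/revstack_rec; set i := index _ _.
have le_i : i < (size w).+1 by rewrite [i < _]index_mem max_entry_mem.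
congr (_ ++ (_ ++ _)); apply: IH.
- by rewrite size_drop /= subSS (leq_trans (leq_subr _ _)).
- by rewrite size_drop /= subSS (leq_trans (leq_subr _ _)).
- by rewrite size_takel ?(leq_trans le_i) // -ltnS (leq_trans le_i).
- by rewrite size_takel ?(leq_trans le_i) // -ltnS (leq_trans le_i).
Qed.

Lemma revstack_recE (d : nat) (w : seq nat) :
  size w <= d -> revstack_rec d w = revstack w.
Proof. by move=> le_d; apply: revstack_rec_fuel. Qed.

Lemma revstackE (m : nat) (L R : seq nat) :
  all (ltn^~ m) L -> all (ltn^~ m) R ->
  revstack (L ++ m :: R) = revstack R ++ revstack L ++ [:: m].
Proof.
move=> ltL ltR; set w := L ++ m :: R.
have max_m : \max_(x <- w) x = m.
  apply/eqP; rewrite eqn_leq; apply/andP; split.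
    apply/bigmax_leqP_seq => x; rewrite mem_cat inE => xw _.
    case/or3P: xw => [xL | /eqP -> // | xR]; apply: ltnW.
      by have /allP/(_ _ xL) := ltL.
    by have /allP/(_ _ xR) := ltR.
  by apply: (@leq_bigmax_seq _ _ _ id) => //; rewrite mem_cat mem_head orbT.
have mNL : m \notin L.
  by apply/negP => /(allP ltL) /=; rewrite ltnn.
have idx : index m w = size L.
  by rewrite index_cat (negbTE mNL) /= eqxx addn0.
have sz : size w = (size L + size R).+1 by rewrite size_cat /= addnS.
have unf d (v : seq nat) : v <> [::] -> revstack_rec d.+1 v =
    let m := \max_(x <- v) x in let i := index m v in
    revstack_rec d (drop i.+1 v) ++ revstack_rec d (take i v) ++ [:: m].
  by case: v.
rewrite {1}/revstack sz unf; last by move=> w0; rewrite w0 in sz.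
cbv zeta; rewrite max_m idx take_size_cat // drop_cat ltnNge leqnSn /=.
by rewrite subSnn /= drop0 !revstack_recE ?leq_addl ?leq_addr.
Qed.

(* Main.v *)
Require Import Defs.
From mathcomp Require Import all_boot all_fingroup.

Set Implicit Arguments.
Unset Strict Implicit.
Unset Printing Implicit Defensive.

(** Both properties obey the same recursion along the decomposition [L m R] of
    a word at its largest entry [m].

    - The output [T(R) T(L) m] is increasing exactly when [T(L)] and [T(R)] are
      increasing and every entry of [R] lies below every entry of [L]
      ([sorted_revstack_cat]); this uses that [T] merely rearranges its input.
    - The word [L m R] avoids 132 exactly when [L] and [R] avoid 132 and every
      entry of [R] lies below every entry of [L] ([word_avoids132_cat]): an
      entry [a] of [L] below an entry [b] of [R] makes [a m b] a 132 pattern,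
      and conversely a 132 pattern contained in neither [L] nor [R] begins in [L]
      and ends in [R], since [m] can only be its largest entry, and so it
      provides such a pair.

    Hence on words with distinct entries [T] produces an increasing word exactly
    when its input avoids 132 ([sorted_revstack]). For the word of a permutation
    of 1, ..., n, the only increasing rearrangement is the identity word. *)

Definition word_avoids132 (w : seq nat) : Prop :=
  forall i j k, i < j -> j < k -> k < size w ->
    ~~ (nth 0 w i < nth 0 w k < nth 0 w j).

(** The induction that follows the recursive calls of revstack sort;
    distinctness is what makes the entries on both sides of [m] strictly
    smaller than [m]. *)
Lemma max_split_ind (P : seq nat -> Prop) :
  P [::] ->
  (forall L m R, uniq (L ++ m :: R) -> all (ltn^~ m) L -> all (ltn^~ m) R ->
     P L -> P R -> P (L ++ m :: R)) ->
  forall w, uniq w -> P w.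
Proof.
move=> P0 Psplit w; have [d] := ubnP (size w).
elim: d w => // d IHd [|x w] // le_d.
have := max_entry_mem x w; set m := \max_(y <- _) y => m_in.
have le_m y : y \in x :: w -> y <= m.
  by move=> y_in; apply: (@leq_bigmax_seq _ _ _ id).
move: le_d le_m; case/splitPr: m_in => L R; rewrite ltnS => le_d le_m uniqw.
have := uniqw; rewrite cat_uniq /= => /and3P[uL /norP[mL _] /andP[mR uR]].
have leD : size L + size R < d by move: le_d; rewrite size_cat /= addnS.
apply: Psplit => //.
- apply/allP => y yL /=; rewrite ltn_neqAle le_m ?mem_cat ?yL // andbT.
  by apply: contraNneq mL => <-.
- apply/allP => y yR /=; rewrite ltn_neqAle le_m ?mem_cat ?inE ?yR ?orbT //.
  by rewrite andbT; apply: contraNneq mR => <-.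
- by apply: IHd => //; apply: leq_ltn_trans leD; apply: leq_addr.
- by apply: IHd => //; apply: leq_ltn_trans leD; apply: leq_addl.
Qed.

Lemma perm_revstack (w : seq nat) : uniq w -> perm_eq (revstack w) w.
Proof.
elim/max_split_ind => {w} // L m R _ ltL ltR permL permR.
rewrite revstackE // perm_catC -catA; apply: perm_cat => //.
by rewrite cat1s perm_cons.
Qed.

Lemma sorted_revstack_cat (m : nat) (L R : seq nat) :
  uniq (L ++ m :: R) -> all (ltn^~ m) L -> all (ltn^~ m) R ->
  sorted ltn (revstack (L ++ m :: R)) =
  [&& allrel ltn R L, sorted ltn (revstack L) & sorted ltn (revstack R)].
Proof.
rewrite cat_uniq /= => /and3P[uL _ /andP[_ uR]] ltL ltR.
have memL := perm_mem (perm_revstack uL).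
have memR := perm_mem (perm_revstack uR).
rewrite revstackE // !(sorted_pairwise ltn_trans) !pairwise_cat.
rewrite allrel_catr !allrel1r /=.
rewrite (eq_allrel_meml _ _ memR) (eq_allrel_memr _ _ memL).
by rewrite !(eq_all_r memL, eq_all_r memR) ltL ltR !andbT /= [X in _ && X]andbC.
Qed.

Lemma word_avoids132_cat (m : nat) (L R : seq nat) :
  uniq (L ++ m :: R) -> all (ltn^~ m) L -> all (ltn^~ m) R ->
  word_avoids132 (L ++ m :: R) <->
  [/\ allrel ltn R L, word_avoids132 L & word_avoids132 R].
Proof.
move=> uniqw ltL ltR; set w := L ++ m :: R.
have nthL i : i < size L -> nth 0 w i = nth 0 L i by rewrite nth_cat => ->.
have nthm : nth 0 w (size L) = m by rewrite nth_cat ltnn subnn.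
have nthR i : nth 0 w (size L + i.+1) = nth 0 R i.
  by rewrite nth_cat ltnNge leq_addr /= addKn.
have sizew : size w = size L + (size R).+1 by rewrite size_cat.
split=> [avw | [ltRL avL avR] i j k ij jk kw].
  split=> [|i j k ij jk kL|i j k ij jk kR].
  - apply/allrelP => b a bR aL; rewrite /= ltnNge.
    apply/negP => le_ab.
    have lt_ab : a < b.
      rewrite ltn_neqAle le_ab andbT; apply/eqP => eq_ab.
      move: uniqw; rewrite cat_uniq => /and3P[_ /hasPn/(_ b) + _].
      by rewrite inE bR orbT -eq_ab aL => /(_ isT).
    (* Since m exceeds every other entry, a m b would be a 132 pattern. *)
    have := avw (index a L) (size L) (size L + (index b R).+1).
    rewrite nthm nthR nthL ?index_mem // !nth_index // lt_ab.
    have -> : b < m by have /allP/(_ _ bR) := ltR.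
    rewrite aL sizew ltn_add2l ltnS index_mem bR.
    by rewrite addnS ltnS leq_addr => /(_ isT isT isT).
  - have jL := ltn_trans jk kL; have iL := ltn_trans ij jL.
    rewrite -!nthL //; apply: avw => //.
    by rewrite sizew (leq_trans kL) ?leq_addr.
  - by rewrite -!nthR; apply: avw; rewrite ?sizew ltn_add2l ?ltnS.
have memR l : size L < l -> l < size w -> nth 0 w l \in R.
  move=> lL lw; rewrite -(subnKC lL) addSnnS nthR mem_nth //.
  by move: lw; rewrite sizew -{1}(subnKC lL) addSnnS ltn_add2l ltnS.
have le_m l : l < size w -> nth 0 w l <= m.
  move=> lw; case: (ltngtP l (size L)) => [lL|lL|->]; last by rewrite nthm.
    by rewrite nthL // ltnW //; apply: (allP ltL); rewrite mem_nth.
  by rewrite ltnW //; apply: (allP ltR); apply: memR.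
have jw := ltn_trans jk kw.
apply/negP => /andP[lt_ik lt_kj].
case: (ltngtP i (size L)) => [iL|iL|iL].
- case: (ltngtP k (size L)) => [kL|kL|kL].
  + have jL := ltn_trans jk kL; have := avL _ _ _ ij jk kL.
    by rewrite -!nthL // lt_ik lt_kj.
  + have /allrelP/(_ _ (nth 0 w i) (memR _ kL kw)) := ltRL.
    by rewrite {1}nthL // mem_nth // => /(_ isT) /=; rewrite ltnNge ltnW.
  + by move: lt_kj; rewrite kL nthm ltnNge le_m.
- have jL := ltn_trans iL ij; have kL := ltn_trans jL jk.
  move: lt_ik lt_kj kw; rewrite sizew.
  move: ij jk; rewrite -(subnKC iL) -(subnKC jL) -(subnKC kL) !addSnnS !nthR.
  rewrite !ltn_add2l !ltnS => ij jk lt_ik lt_kj kR.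
  by have := avR _ _ _ ij jk kR; rewrite lt_ik lt_kj.
- by move: lt_ik; rewrite iL nthm ltnNge le_m.
Qed.

Lemma sorted_revstack (w : seq nat) :
  uniq w -> sorted ltn (revstack w) <-> word_avoids132 w.
Proof.
elim/max_split_ind => {w} [|L m R uniqw ltL ltR IHL IHR]; first by split.
have [avE Eav] := word_avoids132_cat uniqw ltL ltR.
rewrite sorted_revstack_cat //.
split=> [/and3P[ltRL /IHL avL /IHR avR] | /avE[ltRL /IHL sL /IHR sR]].
  exact: Eav.
by rewrite ltRL sL sR.
Qed.

Lemma size_perm_word (n : nat) (s : 'S_n) : size (perm_word s) = n.
Proof. by rewrite size_map size_enum_ord. Qed.

Lemma nth_perm_word (n : nat) (s : 'S_n) (i : 'I_n) :
  nth 0 (perm_word s) i = (s i).+1.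
Proof. by rewrite (nth_map i) ?size_enum_ord // nth_ord_enum. Qed.

Lemma perm_word_uniq (n : nat) (s : 'S_n) : uniq (perm_word s).
Proof.
rewrite map_inj_uniq ?enum_uniq // => i j [] /val_inj.
exact: perm_inj.
Qed.

Lemma perm_word_iota (n : nat) (s : 'S_n) : perm_eq (perm_word s) (iota 1 n).
Proof.
have [//||_ eq_mem] := uniq_min_size (perm_word_uniq s) (s2 := iota 1 n).
- by move=> _ /mapP[i _ ->]; rewrite mem_iota add1n !ltnS ltn_ord.
- by rewrite size_perm_word size_iota.
by apply: uniq_perm; rewrite ?perm_word_uniq ?iota_uniq.
Qed.

Lemma avoids132P (n : nat) (s : 'S_n) :
  reflect (word_avoids132 (perm_word s)) (avoids132 s).
Proof.
apply: (iffP idP) => [av i j k ij jk | av].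
  rewrite size_perm_word => kn.
  have jn := ltn_trans jk kn; have in_ := ltn_trans ij jn.
  have /forallP/(_ (Ordinal in_))/forallP/(_ (Ordinal jn)) := av.
  move/forallP/(_ (Ordinal kn)); rewrite /= ij jk /=.
  have E l (ln : l < n) : nth 0 (perm_word s) l = (s (Ordinal ln)).+1.
    exact: (nth_perm_word s (Ordinal ln)).
  by rewrite (E _ kn) (E _ jn) (E _ in_) !ltnS.
apply/forallP => i; apply/forallP => j; apply/forallP => k.
apply/implyP => /andP[ij jk].
by have := av i j k ij jk; rewrite size_perm_word !nth_perm_word !ltnS; apply.
Qed.

(** [T] rearranges the entries 1, ..., n, and an increasing word is determined
    by its set of entries. *)
Lemma revstack_perm_word_id (n : nat) (s : 'S_n) :
  (revstack (perm_word s) == iota 1 n) = sorted ltn (revstack (perm_word s)).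
Proof.
apply/eqP/idP => [-> | sortedT]; first exact: iota_ltn_sorted.
apply: (sorted_eq leq_trans anti_leq); last 1 first.
- exact: perm_trans (perm_revstack (perm_word_uniq s)) (perm_word_iota s).
- by move: sortedT; rewrite ltn_sorted_uniq_leq => /andP[].
- exact: iota_sorted.
Qed.

Theorem theorem2p4 (n : nat) (hn : 1 <= n) :
  [set s : 'S_n | revstack (perm_word s) == iota 1 n]
  = [set s : 'S_n | avoids132 s].
Proof.
apply/setP => s; rewrite !inE revstack_perm_word_id.
have eqv := sorted_revstack (perm_word_uniq s).
by apply/idP/avoids132P => /eqv.
Qed.
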